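(* Consider an adaptive network of $N$ nodes running the distributed algorithm (U-sup) described in the context, and suppose that: (1) the network is at steady state, that is, all local filters have converged to their final mean-square deviation (MSD) performance, and the supervisors have also converged to their final values; (2) the local supervisors (the choice of $\check\lambda_n(i)$ together with the combination formula for $w_{n,i}$) choose the best option, in terms of MSD, between $\psi_{n,i}$ and $\phi_{n,i}$ at steady state. Then the network is asymptotically globally universal: at steady state, every node is as good as the best node in the network, i.e. $$\mathrm{MSD}_n(i)=\min_{1\le m\le N}\mathrm{MSD}_m(i)\qquad\text{for all } n\in\{1,\dots,N\}.$$
   Context: Network. The network is modeled as an (un)directed graph on $N$ nodes. $\mathcal N_n$ is the set of nodes that have a direct connection with node $n$, including $n$ itself, and $\overline{\mathcal N}_n=\mathcal N_n\setminus\{n\}$ is the strict neighborhood. At each time $i$ node $n$ has access to a scalar measurement $d_n(i)$ and a $1\times M$ row regressor $u_{n,i}$, with $d_n(i)=u_{n,i}w^o+v_n(i)$, where $w^o$ is an unknown $M\times 1$ vector common to all nodes and $v_n(i)$ is noise. $H_{n,i}$ is an $M\times M$ positive definite matrix that defines the local adaptive rule (e.g. $H_{n,i}=\mu_n I$ for LMS, $H_{n,i}=\frac{\mu_n}{\|u_{n,i}\|^2+\epsilon}I$ for NLMS, with step-size $\mu_n$ and small regularization $\epsilon>0$). $E$ denotes expectation and $\|\cdot\|$ the Euclidean norm. Algorithm (U-sup). The fixed combiners satisfy $\overline c_{n\ell}\ge 0$, $\overline c_{n\ell}=0$ for $\ell\notin\overline{\mathcal N}_n$, and $\sum_{\ell\in\overline{\mathcal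 N}_n}\overline c_{n\ell}=1$. The parameters are a limit $a_+$ (typically $a_+=4$), step-sizes $\mu_{a,n}$ (typically chosen in $(0,1]$), filtering parameters $0\ll\nu_n<1$, a regularization parameter $0<\epsilon_p\ll1$, and feedback cycle lengths $L_n$ ($L_n\to\infty$ meaning that the feedback of $w_{n,i}$ into the local filter never occurs). Node $n$ performs at time $i$: $$\lambda_n(i)=\frac{1}{1+e^{-a_n(i-1)}},\qquad \check\lambda_n(i)=\begin{cases}\lambda_n(i), & -a_+<a_n(i-1)<a_+,\\ 0,& a_n(i-1)=-a_+,\\ 1,& a_n(i-1)=a_+,\end{cases}$$ $$\phi_{n,i-1}=\sum_{\ell\in\overline{\mathcal N}_n}\overline c_{n\ell}\,w_{\ell,i-1},\qquad w_{n,i}=\check\lambda_n(i)\,\psi_{n,i-1}+[1-\check\lambda_n(i)]\,\phi_{n,i-1},$$ $$e_n(i)=d_n(i)-u_{n,i}w_{n,i},\qquad p_n(i)=\nu_np_n(i-1)+[1-\nu_n]\,|u_{n,i}(\psi_{n,i-1}-\phi_{n,i-1})|^2,$$ $$a_n(i)=\Bigl[a_n(i-1)+\tfrac{\mu_{a,n}}{p_n(i)+\epsilon_p}\,u_{n,i}(\psi_{n,i-1}-\phi_{n,i-1})\,e_n(i)\,\lambda_n(i)[1-\lambda_n(i)]\Bigr]_{-a_+}^{a_+},$$ $$\psi_{n,a}=\delta_{L_n}(i)\,w_{n,i}+[1-\delta_{L_n}(i)]\,\psi_{n,i-1},\qquad \psi_{n,i}=\psi_{n,a}+H_{n,i}u_{n,i}^{T}[d_n(i)-u_{n,i}\psi_{n,a}],$$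 where $[\cdot]_{-a_+}^{a_+}$ denotes restriction to the interval $[-a_+,a_+]$, and $\delta_{L_n}(i)=\delta(i-rL_n)$ is the Kronecker delta with $r$ a positive integer (so it equals 1 once every $L_n$ iterations and 0 otherwise). Here $\psi_{n,i}$ is the local filter estimate, $\phi_{n,i}$ the fused estimate from the strict neighborhood, and $w_{n,i}$ the output (supervisor estimate) of node $n$. Performance. The MSD of an estimate $x$ of $w^o$ is $E\|w^o-x\|^2$; the local MSD of node $n$ is that of its output, $\mathrm{MSD}_n(i)=E\|w^o-w_{n,i}\|^2$. At steady state the MSD at each node is constant in $i$. Definitions. An adaptive network is globally universal when for all nodes $n\in\{1,\dots,N\}$ it holds that $n$ is as good as the best node in the network, i.e. the best node $m\in\{1,\dots,N\}$. It is asymptotically universal when it is universal for $i\to\infty$, i.e. at steady state.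
   Formalization: Added hypothesis: the directed graph of links carrying positive combiner weights is strongly connected; without it the claim fails, e.g. two disjoint pairs of nodes with zero regressors and different constant estimates have different steady-state MSDs. *)

(* Defs.v *)
From mathcomp Require Import all_boot all_order all_algebra.
From mathcomp Require Import all_classical all_reals all_analysis.

Set Implicit Arguments.
Unset Strict Implicit.
Unset Printing Implicit Defensive.

Import Order.TTheory GRing.Theory Num.Theory.
Import numFieldNormedType.Exports.

Local Open Scope classical_set_scope.
Local Open Scope ring_scope.

(* Squared Euclidean norm; the library norm on matrices is the sup norm. *)
Definition sqnorm2 (R : realType) (M : nat) (x : 'cV[R]_M) : R :=
  \sum_(k < M) x k 0 ^+ 2.

Definition rowdot (R : realType) (M : nat) (u : 'rV[R]_M) (x : 'cV[R]_M) : R :=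
  (u *m x) 0 0.

Definition posdefmx (R : realType) (M : nat) (A : 'M[R]_M) : Prop :=
  A^T = A /\ forall x : 'cV[R]_M, x != 0 -> 0 < (x^T *m A *m x) 0 0.

Definition measurable_mx d (T : measurableType d) (R : realType) (m n : nat)
    (A : T -> 'M[R]_(m, n)) : Prop :=
  forall j k, measurable_fun [set: T] (fun t => A t j k).

Definition cvg_in_probability d (T : measurableType d) (R : realType)
    (P : probability T R) (X : nat -> T -> R) (Y : T -> R) : Prop :=
  forall eps : R, 0 < eps ->
    P [set t | eps <= `|X i t - Y t|] @[i --> \oo] --> 0%E.

(* Extended-real valued: an arbitrary random estimate may have infinite MSD. *)
Definition MSD d (T : measurableType d) (R : realType) (P : probability T R)
    (M : nat) (wo : 'cV[R]_M) (x : T -> 'cV[R]_M) : \bar R :=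
  ('E_P[fun t => sqnorm2 (wo - x t)])%E.

(* [nbh n] is the neighborhood of node [n], including [n] itself; no symmetry
   is imposed, so directed graphs are covered. *)
Definition strict_nbh (N : nat) (nbh : 'I_N -> {set 'I_N}) (n : 'I_N) :
  {set 'I_N} := nbh n :\ n.

(* [fb_cycle n = None] is L_n = +oo (the feedback never occurs). *)
Record usup_params (R : realType) (N : nat) := UsupParams {
  a_max    : R;
  mu_a     : 'I_N -> R;
  nu       : 'I_N -> R;
  eps_p    : R;
  fb_cycle : 'I_N -> option nat;
  cbar     : 'I_N -> 'I_N -> R }.

Record usup_params_ok (R : realType) (N : nat) (nbh : 'I_N -> {set 'I_N})
    (prm : usup_params R N) : Prop := {
  a_max_gt0 : 0 < a_max prm;
  mu_a_gt0  : forall n, 0 < mu_a prm n;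
  nu_itv    : forall n, 0 < nu prm n < 1;
  eps_p_itv : 0 < eps_p prm < 1;
  fb_cycle_gt0 : forall n l, fb_cycle prm n = Some l -> (0 < l)%N;
  cbar_ge0  : forall n l, 0 <= cbar prm n l;
  cbar_out  : forall n l, l \notin strict_nbh nbh n -> cbar prm n l = 0;
  cbar_sum  : forall n, \sum_(l in strict_nbh nbh n) cbar prm n l = 1 }.

(* Connectedness through links actually used by the combiners: a zero weight on
   a physical link carries no information, and separate components would have
   unrelated MSDs. *)
Definition strongly_connected (R : realType) (N : nat)
    (c : 'I_N -> 'I_N -> R) : Prop :=
  forall n m : 'I_N, connect [rel k l | 0 < c k l] n m.

Record usup_data (T : Type) (R : realType) (N M : nat) := UsupData {
  regr  : 'I_N -> nat -> T -> 'rV[R]_M;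
  noise : 'I_N -> nat -> T -> R;
  gain  : 'I_N -> nat -> T -> 'M[R]_M }.

Definition meas (T : Type) (R : realType) (N M : nat) (wo : 'cV[R]_M)
    (D : usup_data T R N M) (n : 'I_N) (i : nat) (t : T) : R :=
  rowdot (regr D n i t) wo + noise D n i t.

Record usup_data_ok d (T : measurableType d) (R : realType) (N M : nat)
    (D : usup_data T R N M) : Prop := {
  regr_meas   : forall n i, measurable_mx (regr D n i);
  noise_meas  : forall n i, measurable_fun [set: T] (noise D n i);
  gain_meas   : forall n i, measurable_mx (gain D n i);
  gain_posdef : forall n i t, posdefmx (gain D n i t) }.

Definition lambda (R : realType) (a : R) : R := (1 + expR (- a))^-1.

Definition lambda_check (R : realType) (a_plus a : R) : R :=
  if a == - a_plus then 0 else if a == a_plus then 1 else lambda a.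

Definition clip (R : realType) (a_plus x : R) : R :=
  Num.max (- a_plus) (Num.min x a_plus).

(* delta_L(i) = 1 iff i = r * L for some positive integer r. *)
Definition feedback (R : realType) (L : option nat) (i : nat) : R :=
  if L is Some l then ((0 < i) && (l %| i))%N%:R else 0.

(* Index 0 carries the initial conditions; the recursions hold from time 1. *)
Record usup_process (T : Type) (R : realType) (N M : nat) := UsupProcess {
  w     : 'I_N -> nat -> T -> 'cV[R]_M;
  phi   : 'I_N -> nat -> T -> 'cV[R]_M;
  psi   : 'I_N -> nat -> T -> 'cV[R]_M;
  psi_a : 'I_N -> nat -> T -> 'cV[R]_M;
  lam_c : 'I_N -> nat -> T -> R;
  err   : 'I_N -> nat -> T -> R;
  pow   : 'I_N -> nat -> T -> R;
  aux   : 'I_N -> nat -> T -> R }.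

Record usup_init d (T : measurableType d) (R : realType) (N M : nat)
    (prm : usup_params R N) (X : usup_process T R N M) : Prop := {
  w0_meas   : forall n, measurable_mx (w X n 0%N);
  psi0_meas : forall n, measurable_mx (psi X n 0%N);
  pow0_meas : forall n, measurable_fun [set: T] (pow X n 0%N);
  aux0_meas : forall n, measurable_fun [set: T] (aux X n 0%N);
  pow0_ge0  : forall n t, 0 <= pow X n 0%N t;
  aux0_itv  : forall n t, - a_max prm <= aux X n 0%N t <= a_max prm }.

(* Below, [i.+1] is the current time and [i] the previous one. *)
Record usup_run (T : Type) (R : realType) (N M : nat) (wo : 'cV[R]_M)
    (nbh : 'I_N -> {set 'I_N}) (prm : usup_params R N)
    (D : usup_data T R N M) (X : usup_process T R N M) : Prop := {
  phiE : forall n i t,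
    phi X n i t = \sum_(l in strict_nbh nbh n) cbar prm n l *: w X l i t;
  lam_cE : forall n i t,
    lam_c X n i.+1 t = lambda_check (a_max prm) (aux X n i t);
  wE : forall n i t,
    w X n i.+1 t = lam_c X n i.+1 t *: psi X n i t
                   + (1 - lam_c X n i.+1 t) *: phi X n i t;
  errE : forall n i t,
    err X n i.+1 t = meas wo D n i.+1 t - rowdot (regr D n i.+1 t) (w X n i.+1 t);
  powE : forall n i t,
    pow X n i.+1 t = nu prm n * pow X n i t
      + (1 - nu prm n)
        * `|rowdot (regr D n i.+1 t) (psi X n i t - phi X n i t)| ^+ 2;
  auxE : forall n i t,
    aux X n i.+1 t = clip (a_max prm)
      (aux X n i t
       + mu_a prm n / (pow X n i.+1 t + eps_p prm)
         * rowdot (regr D n i.+1 t) (psi X n i t - phi X n i t)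
         * err X n i.+1 t
         * lambda (aux X n i t) * (1 - lambda (aux X n i t)));
  psi_aE : forall n i t,
    psi_a X n i.+1 t = feedback R (fb_cycle prm n) i.+1 *: w X n i.+1 t
      + (1 - feedback R (fb_cycle prm n) i.+1) *: psi X n i t;
  psiE : forall n i t,
    psi X n i.+1 t = psi_a X n i.+1 t
      + (meas wo D n i.+1 t - rowdot (regr D n i.+1 t) (psi_a X n i.+1 t))
        *: (gain D n i.+1 t *m (regr D n i.+1 t)^T) }.

Record steady_state d (T : measurableType d) (R : realType)
    (P : probability T R) (N M : nat) (wo : 'cV[R]_M)
    (X : usup_process T R N M) : Prop := {
  local_filters_cvg : forall n, exists J : R,
    MSD P wo (psi X n i) @[i --> \oo] --> J%:E;
  supervisors_cvg : forall n, exists2 lam_inf : T -> R,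
    measurable_fun [set: T] lam_inf & cvg_in_probability P (lam_c X n) lam_inf;
  outputs_cvg : forall n, exists J : R,
    MSD P wo (w X n i) @[i --> \oo] --> J%:E }.

Definition node_MSD d (T : measurableType d) (R : realType)
    (P : probability T R) (N M : nat) (wo : 'cV[R]_M)
    (X : usup_process T R N M) (n : 'I_N) (i : nat) : \bar R :=
  MSD P wo (w X n i).

Definition steady_MSD d (T : measurableType d) (R : realType)
    (P : probability T R) (N M : nat) (wo : 'cV[R]_M)
    (X : usup_process T R N M) (n : 'I_N) : \bar R :=
  limn (node_MSD P wo X n).

(* The final MSD of the output is that of the better of the two estimates the
   supervisor combines; the MSD of phi is not required to converge by itself. *)
Definition supervisors_choose_best d (T : measurableType d) (R : realType)
    (P : probability T R) (N M : nat) (wo : 'cV[R]_M)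
    (X : usup_process T R N M) : Prop :=
  forall n, mine (MSD P wo (psi X n i)) (MSD P wo (phi X n i)) @[i --> \oo]
              --> steady_MSD P wo X n.

(* [perf n] is the MSD of node [n]: each node is as good as the best one. *)
Definition globally_universal (R : realType) (N : nat)
    (perf : 'I_N -> \bar R) : Prop :=
  forall n, perf n = \big[mine/+oo%E]_(m < N) perf m.

(* Main.v *)
Require Import Defs.
From mathcomp Require Import all_boot all_order all_algebra.
From mathcomp Require Import all_classical all_reals all_analysis.
From mathcomp Require Import measurable_realfun.
Import Order.TTheory GRing.Theory Num.Theory.
Import numFieldNormedType.Exports.
Local Open Scope classical_set_scope.
Local Open Scope ring_scope.

(** At steady state let [J n] be the limiting MSD of the output of node [n].
    The fused estimate [phi_n] is a convex combination of the outputs of the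
    neighbors, so by Jensen's inequality ([MSD_convex_comb]) its MSD is at most
    the same combination of the MSDs of those outputs.  As the supervisor
    achieves the better of [psi_n] and [phi_n], in the limit
    [J n <= \sum_l cbar n l * J l]: the function [J] is subharmonic for the
    stochastic matrix of the combiners.  At a node where [J] is maximal this
    forces [J l = J n] for every [l] with [cbar n l > 0], and since every node
    is reached along such links, [J] is constant ([subharmonic_constant]).
    Hence every node attains the minimum.

    The integral is additive only on measurable functions, so Jensen's
    inequality needs the estimates to be random variables; this is proved by
    induction on time along the recursions of the algorithm
    ([usup_measurable]). *)

Set Implicit Arguments.
Unset Strict Implicit.

(** * Measurability of the processes generated by the algorithm *)

Lemma measurable_funV_gt0 (d : measure_display) (T : measurableType d)
    (R : realType) (f : T -> R) :
  (forall t, 0 < f t) -> measurable_fun [set: T] f ->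
  measurable_fun [set: T] (fun t => (f t)^-1).
Proof.
move=> f_gt0 mf.
(* On positive reals the inverse is [expR \o -%R \o ln]. *)
have -> : (fun t => (f t)^-1) = (fun t => expR (- ln (f t))).
  by apply/funext => t; rewrite expRN lnK // posrE.
apply: (measurableT_comp (@measurable_expR R)).
apply: measurable_funN; exact: (measurableT_comp (@measurable_ln R) mf).
Qed.

Lemma measurable_lambda (d : measure_display) (T : measurableType d)
    (R : realType) (f : T -> R) :
  measurable_fun [set: T] f -> measurable_fun [set: T] (fun t => lambda (f t)).
Proof.
move=> mf; apply: measurable_funV_gt0 => [t|].
  by rewrite ltr_pwDl // expR_ge0.
apply: measurable_funD; first exact: measurable_cst.
apply: (measurableT_comp (@measurable_expR R)).
exact: measurable_funN.
Qed.

Lemma measurable_lambda_check (d : measure_display) (T : measurableType d)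
    (R : realType) (a : R) (f : T -> R) :
  measurable_fun [set: T] f ->
  measurable_fun [set: T] (fun t => lambda_check a (f t)).
Proof.
move=> mf; rewrite /lambda_check; apply: measurable_fun_ifT.
- exact: (measurable_fun_eqr mf (measurable_cst _)).
- exact: measurable_cst.
- apply: measurable_fun_ifT.
  + exact: (measurable_fun_eqr mf (measurable_cst _)).
  + exact: measurable_cst.
  + exact: measurable_lambda.
Qed.

Lemma measurable_clip (d : measure_display) (T : measurableType d)
    (R : realType) (a : R) (f : T -> R) :
  measurable_fun [set: T] f -> measurable_fun [set: T] (fun t => clip a (f t)).
Proof.
move=> mf; apply: measurable_maxr; first exact: measurable_cst.
by apply: measurable_minr => //; exact: measurable_cst.
Qed.

Lemma measurable_mx_add (d : measure_display) (T : measurableType d)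
    (R : realType) (m n : nat) (A B : T -> 'M[R]_(m, n)) :
  measurable_mx A -> measurable_mx B -> measurable_mx (fun t => A t + B t).
Proof.
move=> mA mB j k; under eq_fun do rewrite mxE.
exact: measurable_funD.
Qed.

Lemma measurable_mx_scale (d : measure_display) (T : measurableType d)
    (R : realType) (m n : nat) (f : T -> R) (A : T -> 'M[R]_(m, n)) :
  measurable_fun [set: T] f -> measurable_mx A ->
  measurable_mx (fun t => f t *: A t).
Proof.
move=> mf mA j k; under eq_fun do rewrite mxE.
exact: measurable_funM.
Qed.

Lemma measurable_mx_sub (d : measure_display) (T : measurableType d)
    (R : realType) (m n : nat) (A B : T -> 'M[R]_(m, n)) :
  measurable_mx A -> measurable_mx B -> measurable_mx (fun t => A t - B t).
Proof.
move=> mA mB j k; under eq_fun do rewrite !mxE.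
exact: measurable_funB.
Qed.

Lemma measurable_mx_sum (d : measure_display) (T : measurableType d)
    (R : realType) (m n : nat) (I : finType) (A : I -> T -> 'M[R]_(m, n)) :
  (forall l, measurable_mx (A l)) -> measurable_mx (fun t => \sum_l A l t).
Proof.
move=> mA j k; under eq_fun do rewrite summxE.
by apply: measurable_sum => l; exact: mA.
Qed.

Lemma measurable_mx_mul (d : measure_display) (T : measurableType d)
    (R : realType) (m n p : nat) (A : T -> 'M[R]_(m, n))
    (B : T -> 'M[R]_(n, p)) :
  measurable_mx A -> measurable_mx B -> measurable_mx (fun t => A t *m B t).
Proof.
move=> mA mB j k; under eq_fun do rewrite mxE.
by apply: measurable_sum => l; exact: measurable_funM.
Qed.

Lemma measurable_mx_tr (d : measure_display) (T : measurableType d)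
    (R : realType) (m n : nat) (A : T -> 'M[R]_(m, n)) :
  measurable_mx A -> measurable_mx (fun t => (A t)^T).
Proof. by move=> mA j k; under eq_fun do rewrite mxE; exact: mA. Qed.

Lemma measurable_mx_cst (d : measure_display) (T : measurableType d)
    (R : realType) (m n : nat) (A : 'M[R]_(m, n)) :
  measurable_mx (fun _ : T => A).
Proof. by move=> j k; exact: measurable_cst. Qed.

Lemma measurable_rowdot (d : measure_display) (T : measurableType d)
    (R : realType) (M : nat) (u : T -> 'rV[R]_M) (x : T -> 'cV[R]_M) :
  measurable_mx u -> measurable_mx x ->
  measurable_fun [set: T] (fun t => rowdot (u t) (x t)).
Proof. by move=> mu mx; exact: measurable_mx_mul. Qed.

Lemma measurable_sqnorm2 (d : measure_display) (T : measurableType d)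
    (R : realType) (M : nat) (x : T -> 'cV[R]_M) :
  measurable_mx x -> measurable_fun [set: T] (fun t => sqnorm2 (x t)).
Proof.
by move=> mx; apply: measurable_sum => k; apply: measurable_funX; exact: mx.
Qed.

(** The combiners vanish outside the strict neighborhood, so that the fused
    estimate is a sum over the whole network. *)
Lemma phi_sum_all (T : Type) (R : realType) (N M : nat) (wo : 'cV[R]_M)
    (nbh : 'I_N -> {set 'I_N}) (prm : usup_params R N)
    (D : usup_data T R N M) (X : usup_process T R N M) :
  usup_params_ok nbh prm -> usup_run wo nbh prm D X ->
  forall n i t, phi X n i t = \sum_l cbar prm n l *: w X l i t.
Proof.
move=> ok run n i t; rewrite (phiE run) big_mkcond; apply: eq_bigr => l _.
by case: ifPn => // /(cbar_out ok) ->; rewrite scale0r.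
Qed.

Lemma cbar_sum_all (R : realType) (N : nat) (nbh : 'I_N -> {set 'I_N})
    (prm : usup_params R N) (n : 'I_N) :
  usup_params_ok nbh prm -> \sum_l cbar prm n l = 1.
Proof.
move=> ok; rewrite -(cbar_sum ok n) [RHS]big_mkcond; apply: eq_bigr => l _.
by case: ifPn => // /(cbar_out ok).
Qed.

(** The state carried from one time step to the next consists of [w], [psi],
    [pow] and [aux].  Nonnegativity of [pow] belongs to the invariant because
    it makes the normalization [pow + eps_p] of the step-size positive. *)
Lemma usup_measurable (d : measure_display) (T : measurableType d)
    (R : realType) (N M : nat) (wo : 'cV[R]_M)
    (nbh : 'I_N -> {set 'I_N}) (prm : usup_params R N)
    (D : usup_data T R N M) (X : usup_process T R N M) :
  usup_params_ok nbh prm -> usup_data_ok D -> usup_init prm X ->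
  usup_run wo nbh prm D X ->
  forall i n, [/\ measurable_mx (w X n i), measurable_mx (psi X n i),
    measurable_fun [set: T] (pow X n i), measurable_fun [set: T] (aux X n i)
    & forall t, 0 <= pow X n i t].
Proof.
move=> ok dok init run; elim=> [|i IH] n.
  split; [exact: (w0_meas init)|exact: (psi0_meas init)|
    exact: (pow0_meas init)|exact: (aux0_meas init)|exact: (pow0_ge0 init)].
have [mw mpsi mpow maux pow_ge0] := IH n.
have mu := regr_meas dok n i.+1.
have mphi : measurable_mx (phi X n i).
  rewrite (_ : phi X n i = fun t => \sum_l cbar prm n l *: w X l i t).
    apply: measurable_mx_sum => l; apply: measurable_mx_scale.
      exact: measurable_cst.
    by have [] := IH l.
  by apply/funext => t; exact: phi_sum_all ok run _ _ _.
have mlam : measurable_fun [set: T] (lam_c X n i.+1).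
  rewrite (_ : lam_c X n i.+1 =
      fun t => lambda_check (a_max prm) (aux X n i t)).
    exact: measurable_lambda_check.
  by apply/funext => t; rewrite (lam_cE run).
have mw' : measurable_mx (w X n i.+1).
  rewrite (_ : w X n i.+1 = fun t => lam_c X n i.+1 t *: psi X n i t
                   + (1 - lam_c X n i.+1 t) *: phi X n i t).
    apply: measurable_mx_add; apply: measurable_mx_scale => //.
    by apply: measurable_funB => //; exact: measurable_cst.
  by apply/funext => t; rewrite (wE run).
have mmeas : measurable_fun [set: T] (meas wo D n i.+1).
  apply: measurable_funD; last exact: noise_meas dok _ _.
  by apply: measurable_rowdot => //; exact: measurable_mx_cst.
have merr : measurable_fun [set: T] (err X n i.+1).
  rewrite (_ : err X n i.+1 = fun t =>
      meas wo D n i.+1 t - rowdot (regr D n i.+1 t) (w X n i.+1 t)).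
    by apply: measurable_funB => //; exact: measurable_rowdot.
  by apply/funext => t; rewrite (errE run).
have mdiff : measurable_fun [set: T]
    (fun t => rowdot (regr D n i.+1 t) (psi X n i t - phi X n i t)).
  by apply: measurable_rowdot => //; exact: measurable_mx_sub.
have /andP[nu_gt0 nu_lt1] := nu_itv ok n.
have pow_ge0' t : 0 <= pow X n i.+1 t.
  rewrite (powE run); apply: addr_ge0; apply: mulr_ge0 => //; first exact: ltW.
  by rewrite subr_ge0 ltW.
have mpow' : measurable_fun [set: T] (pow X n i.+1).
  rewrite (_ : pow X n i.+1 = fun t => nu prm n * pow X n i t
      + (1 - nu prm n)
        * `|rowdot (regr D n i.+1 t) (psi X n i t - phi X n i t)| ^+ 2).
    apply: measurable_funD; apply: measurable_funM => //;
      try exact: measurable_cst.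
    apply: measurable_funX.
    exact: (measurableT_comp (@normr_measurable R setT) mdiff).
  by apply/funext => t; rewrite (powE run).
have mstep : measurable_fun [set: T]
    (fun t => mu_a prm n / (pow X n i.+1 t + eps_p prm)).
  apply: measurable_funM; first exact: measurable_cst.
  apply: measurable_funV_gt0 => [t|].
    by rewrite ltr_wpDl //; have /andP[] := eps_p_itv ok.
  by apply: measurable_funD => //; exact: measurable_cst.
have mlambda := measurable_lambda maux.
have maux' : measurable_fun [set: T] (aux X n i.+1).
  rewrite (_ : aux X n i.+1 = fun t => clip (a_max prm)
      (aux X n i t
       + mu_a prm n / (pow X n i.+1 t + eps_p prm)
         * rowdot (regr D n i.+1 t) (psi X n i t - phi X n i t)
         * err X n i.+1 t
         * lambda (aux X n i t) * (1 - lambda (aux X n i t)))).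
    apply: measurable_clip; apply: measurable_funD => //.
    apply: measurable_funM; last first.
      by apply: measurable_funB => //; exact: measurable_cst.
    apply: measurable_funM => //; apply: measurable_funM => //.
    exact: measurable_funM.
  by apply/funext => t; rewrite (auxE run).
have mpsi_a : measurable_mx (psi_a X n i.+1).
  rewrite (_ : psi_a X n i.+1 = fun t =>
      feedback R (fb_cycle prm n) i.+1 *: w X n i.+1 t
      + (1 - feedback R (fb_cycle prm n) i.+1) *: psi X n i t).
    by apply: measurable_mx_add; apply: measurable_mx_scale => //;
      exact: measurable_cst.
  by apply/funext => t; rewrite (psi_aE run).
have mpsi' : measurable_mx (psi X n i.+1).
  rewrite (_ : psi X n i.+1 = fun t => psi_a X n i.+1 t
      + (meas wo D n i.+1 t - rowdot (regr D n i.+1 t) (psi_a X n i.+1 t))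
        *: (gain D n i.+1 t *m (regr D n i.+1 t)^T)).
    apply: measurable_mx_add => //; apply: measurable_mx_scale.
      by apply: measurable_funB => //; exact: measurable_rowdot.
    apply: measurable_mx_mul; first exact: gain_meas dok _ _.
    exact: measurable_mx_tr.
  by apply/funext => t; rewrite (psiE run).
by split.
Qed.

(** * Convexity of the mean-square deviation *)

Lemma sqr_convex_comb (R : realFieldType) (I : finType) (c y : I -> R) :
  (forall l, 0 <= c l) -> \sum_l c l = 1 ->
  (\sum_l c l * y l) ^+ 2 <= \sum_l c l * y l ^+ 2.
Proof.
move=> c_ge0 c_sum; set b := \sum_l c l * y l.
(* The difference of the two sides is the variance of [y] under [c]. *)
have var : \sum_l c l * (y l - b) ^+ 2 = \sum_l c l * y l ^+ 2 - b ^+ 2.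
  under eq_bigr do rewrite sqrrB mulrDr mulrBr.
  rewrite big_split sumrB /= -mulr_suml c_sum mul1r.
  have -> : \sum_l c l * (y l * b *+ 2) = b * b *+ 2.
    rewrite {2}/b mulr_suml -sumrMnl; apply: eq_bigr => l _.
    by rewrite mulrnAr mulrA.
  by rewrite -expr2 mulr2n opprD addrA subrK.
rewrite -subr_ge0 -var; apply: sumr_ge0 => l _.
by rewrite mulr_ge0 ?sqr_ge0.
Qed.

Lemma sqnorm2_ge0 (R : realType) (M : nat) (x : 'cV[R]_M) : 0 <= sqnorm2 x.
Proof. by apply: sumr_ge0 => k _; exact: sqr_ge0. Qed.

Lemma sqnorm2_convex_comb (R : realType) (M : nat) (I : finType)
    (wo : 'cV[R]_M) (c : I -> R) (x : I -> 'cV[R]_M) :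
  (forall l, 0 <= c l) -> \sum_l c l = 1 ->
  sqnorm2 (wo - \sum_l c l *: x l) <= \sum_l c l * sqnorm2 (wo - x l).
Proof.
move=> c_ge0 c_sum.
under [leRHS]eq_bigr do rewrite mulr_sumr.
rewrite exchange_big; apply: ler_sum => k _ /=.
suff -> : (wo - \sum_l c l *: x l) k 0 = \sum_l c l * (wo - x l) k 0.
  exact: sqr_convex_comb.
rewrite !mxE summxE -[wo k 0]mul1r -c_sum mulr_suml -sumrB.
by apply: eq_bigr => l _; rewrite !mxE mulrBr.
Qed.

Lemma MSD_ge0 (d : measure_display) (T : measurableType d) (R : realType)
    (P : probability T R) (M : nat) (wo : 'cV[R]_M) (x : T -> 'cV[R]_M) :
  (0 <= MSD P wo x)%E.
Proof.
rewrite /MSD unlock; apply: integral_ge0 => t _.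
by rewrite lee_fin sqnorm2_ge0.
Qed.

(** Jensen's inequality for the squared Euclidean norm; the MSDs may be
    infinite. *)
Lemma MSD_convex_comb (d : measure_display) (T : measurableType d)
    (R : realType) (P : probability T R) (M : nat) (I : finType)
    (wo : 'cV[R]_M) (c : I -> R) (x : I -> T -> 'cV[R]_M) :
  (forall l, 0 <= c l) -> \sum_l c l = 1 ->
  (forall l, measurable_mx (x l)) ->
  (MSD P wo (fun t => \sum_l c l *: x l t)%R
     <= \sum_l (c l)%:E * MSD P wo (x l))%E.
Proof.
move=> c_ge0 c_sum mx; rewrite /MSD unlock.
have msq (y : T -> 'cV[R]_M) : measurable_mx y ->
    measurable_fun [set: T] (fun t => (sqnorm2 (wo - y t))%:E).
  move=> my; apply/measurable_EFinP; apply: measurable_sqnorm2.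
  by apply: measurable_mx_sub => //; exact: measurable_mx_cst.
have mcsq l : measurable_fun [set: T]
    (fun t => (c l)%:E * (sqnorm2 (wo - x l t))%:E)%E.
  apply: emeasurable_funM; [exact: measurable_cst|exact: msq].
have csq_ge0 l t : (0 <= (c l)%:E * (sqnorm2 (wo - x l t))%:E)%E.
  by rewrite -EFinM lee_fin mulr_ge0 // sqnorm2_ge0.
have -> : (\sum_l (c l)%:E * \int[P]_t (sqnorm2 (wo - x l t))%:E =
    \int[P]_t \sum_l (c l)%:E * (sqnorm2 (wo - x l t))%:E)%E.
  rewrite ge0_integral_sum //; apply: eq_bigr => l _.
  rewrite ge0_integralZl_EFin //; last exact: msq.
  by move=> t _; rewrite lee_fin sqnorm2_ge0.
apply: ge0_le_integral => //.
- by move=> t _; rewrite lee_fin sqnorm2_ge0.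
- apply: msq; apply: measurable_mx_sum => l.
  by apply: measurable_mx_scale => //; exact: measurable_cst.
- by apply: emeasurable_sum.
- move=> t _; rewrite [leRHS](_ : _ = (\sum_l c l * sqnorm2 (wo - x l t))%:E).
    by rewrite lee_fin; exact: sqnorm2_convex_comb.
  by rewrite -sumEFin.
Qed.

(** * The maximum principle *)

(** A subharmonic function of an irreducible stochastic matrix is constant. *)
Lemma subharmonic_constant (R : realFieldType) (I : finType)
    (c : I -> I -> R) (J : I -> R) :
  (forall n l, 0 <= c n l) -> (forall n, \sum_l c n l = 1) ->
  (forall n m, connect [rel k l | 0 < c k l] n m) ->
  (forall n, J n <= \sum_l c n l * J l) ->
  forall n m, J n = J m.
Proof.
move=> c_ge0 c_sum conn subh n m.
case: (@arg_maxP _ _ _ n predT J) => // n0 _ n0_max.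
have J_max l : J l <= J n0 by exact: n0_max.
have step k l : J k = J n0 -> 0 < c k l -> J l = J n0.
  move=> Jk ckl; apply/eqP; rewrite eq_le J_max //= leNgt; apply/negP => Jl_lt.
  (* A strictly smaller value at [l] would pull the average at [k] below the
     maximum. *)
  suff : J k < J n0 by rewrite Jk ltxx.
  apply: le_lt_trans (subh k) _.
  rewrite -[ltRHS]mul1r -(c_sum k) mulr_suml.
  rewrite (bigD1 l) //= [ltRHS](bigD1 l) //= ltr_leD ?ltr_pM2l //.
  by apply: ler_sum => j _; apply: ler_wpM2l => //; exact: J_max.
(* Maximality of [J] propagates along the path from [n0] to [k]. *)
have all_max k : J k = J n0.
  have /connectP[p pth ->] := conn n0 k.
  have : J n0 = J n0 by [].
  move: {1 2 4}n0 pth; elim: p => [|j p IH] k' //= /andP[ck'j pth] Jk'.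
  by apply: IH pth _; exact: step Jk' ck'j.
by rewrite !all_max.
Qed.

(** Over a nonempty network the minimum with default value [+oo] of a constant
    function is that constant. *)
Lemma globally_universal_constant (R : realType) (N : nat)
    (perf : 'I_N -> \bar R) :
  (forall n m, perf n = perf m) -> globally_universal perf.
Proof.
move=> perf_eq n; apply/eqP; rewrite eq_le; apply/andP; split.
  by apply: le_bigmin => [|m _]; [exact: leey|rewrite (perf_eq n m)].
exact: bigmin_le.
Qed.

Unset Implicit Arguments.
Set Strict Implicit.

Theorem theorem2 (d : measure_display) (T : measurableType d) (R : realType)
    (P : probability T R) (N M : nat) (wo : 'cV[R]_M)
    (nbh : 'I_N -> {set 'I_N}) (prm : usup_params R N)
    (D : usup_data T R N M) (X : usup_process T R N M)
    (self_nbh : forall n, n \in nbh n)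
    (prm_ok : usup_params_ok nbh prm)
    (connected : strongly_connected (cbar prm))
    (D_ok : usup_data_ok D)
    (X_init : usup_init prm X)
    (X_run : usup_run wo nbh prm D X)
    (X_steady : steady_state P wo X)
    (X_best : supervisors_choose_best P wo X) :
  globally_universal (steady_MSD P wo X)
  /\ (forall i : nat,
        (forall n j, (i <= j)%N -> node_MSD P wo X n j = node_MSD P wo X n i) ->
        globally_universal (fun n => node_MSD P wo X n i)).
Proof.
suff const n m : steady_MSD P wo X n = steady_MSD P wo X m.
  split; first exact: globally_universal_constant.
  move=> i msd_cst; apply: globally_universal_constant => n m.
  suff steadyE k : steady_MSD P wo X k = node_MSD P wo X k i.
    by rewrite -!steadyE.
  apply: lim_near_cst => //.
  by exists i => // j /= ij; exact: msd_cst.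
have [J wJ] : exists J : 'I_N -> R,
    forall k, MSD P wo (w X k i) @[i --> \oo] --> (J k)%:E.
  by have /choice[J JP] := outputs_cvg X_steady; exists J.
have steadyE k : steady_MSD P wo X k = (J k)%:E by exact: cvg_lim (wJ k).
rewrite !steadyE; congr (_%:E).
apply: (@subharmonic_constant _ _ (cbar prm)) => //.
- exact: cbar_ge0 prm_ok.
- by move=> k; exact: cbar_sum_all prm_ok.
move=> k; rewrite -lee_fin -steadyE -sumEFin.
under eq_bigr do rewrite EFinM.
have bound_cvg : (\sum_l (cbar prm k l)%:E * MSD P wo (w X l i))%E @[i --> \oo]
    --> (\sum_l (cbar prm k l)%:E * (J l)%:E)%E.
  apply: cvg_nnesum => l _.
    apply: nearW => i; apply: mule_ge0; last exact: MSD_ge0.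
    by rewrite lee_fin; exact: cbar_ge0 prm_ok _ _.
  by apply: cvgeZl => //; exact: wJ.
(* The MSD of [phi] need not converge: only its upper bound is passed to the
   limit. *)
apply: (lee_cvg_to (X_best k) bound_cvg).
apply: nearW => i; rewrite ge_min; apply/orP; right.
rewrite (_ : phi X k i = fun t => \sum_l cbar prm k l *: w X l i t).
  apply: MSD_convex_comb => [l||l].
  - exact: cbar_ge0 prm_ok _ _.
  - exact: cbar_sum_all prm_ok.
  - by have [] := usup_measurable prm_ok D_ok X_init X_run i l.
by apply/funext => t; exact: phi_sum_all prm_ok X_run _ _ _.
Qed.
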